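(* Let $T$ be a set and let $X=\{X_t\}_{t\in T}$ be a simple max-stable process. The dependency set $\mathcal{K}$ of $X$ is the largest (with respect to inclusion) compact convex set $\mathcal{K}\subset[0,\infty)^T$ satisfying $$\ell_M(x)=\sup\Bigl\{\sum_{t\in M}x_ty_t:\ y\in\mathcal{K}\Bigr\}\qquad\text{for all }x\in[0,\infty)^M\text{ and all }\varnothing\neq M\in\mathcal{F}(T),$$ where $\ell_M$ is the stable tail dependence function of $\{X_t\}_{t\in M}$.
   Context: $\mathcal{F}(T)$ is the set of finite subsets of $T$; $[0,\infty)^T$ carries the product topology. Simple max-stable process: a process $X=\{X_t\}_{t\in T}$ with $\mathbb{P}(X_t\le x)=e^{-1/x}$ for all $t\in T$, $x>0$, such that for every $n\in\mathbb{N}$ and independent copies $X^{(1)},\dots,X^{(n)}$ of $X$ the process $\{\bigvee_{i=1}^nX^{(i)}_t\}_{t\in T}$ has the same law (finite-dimensional distributions) as $\{nX_t\}_{t\in T}$. Stable tail dependence function of $\{X_t\}_{t\in M}$, $M$ non-empty finite: $\ell_M(x)=-\log\mathbb{P}(X_t\le1/x_t,\ t\in M)$, $x\in[0,\infty)^M$ (with $1/0=\infty$). Finite-dimensional dependency set $\mathcal{K}_M$ of $\{X_t\}_{t\in M}$: the largest (with respect to inclusion) compact convex set $\mathcal{K}_M\subset[0,\infty)^M$ with $\ell_M(x)=\sup\{\langle x,y\rangle:y\in\mathcal{K}_M\}$ for all $x\in[0,\infty)^M$, where $\langle x,y\rangle=\sum_{t\in M}x_ty_t$; equivalently $\mathcal{K}_M=\bigcap_{x\in[0,\infty)^M}\{y\in[0,\infty)^M:\langle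 x,y\rangle\le\ell_M(x)\}$. Dependency set of the process $X$: $\mathcal{K}:=\bigcap_{M\in\mathcal{F}(T)\setminus\{\varnothing\}}\mathrm{pr}_M^{-1}(\mathcal{K}_M)\subset[0,\infty)^T$, where $\mathrm{pr}_M:[0,\infty)^T\to[0,\infty)^M$ is the coordinate projection. *)

(* Defs.v *)
From HB Require Import structures.
From mathcomp Require Import all_boot all_order all_algebra finmap.
From mathcomp Require Import all_classical all_reals all_analysis.

Set Implicit Arguments.
Unset Strict Implicit.
Unset Printing Implicit Defensive.

Import Order.TTheory GRing.Theory Num.Theory.
Import numFieldNormedType.Exports.

Local Open Scope classical_set_scope.
Local Open Scope ring_scope.

Definition same_fdd (R : realType) (T : Type)
    (d : measure_display) (Omega : measurableType d) (P : probability Omega R)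
    (d' : measure_display) (Omega' : measurableType d')
    (P' : probability Omega' R)
    (X : T -> Omega -> R) (Y : T -> Omega' -> R) : Prop :=
  forall (n : nat) (t : n.-tuple T) (B : set (n.-tuple R)), measurable B ->
    P [set w | B [tuple X (tnth t i) w | i < n]] =
    P' [set w | B [tuple Y (tnth t i) w | i < n]].

Definition sigma_process (R : realType) (T : Type)
    (d : measure_display) (Omega : measurableType d)
    (Y : T -> Omega -> R) : set_system Omega :=
  <<s [set A | exists (t : T) (B : set R), measurable B /\ A = Y t @^-1` B] >>.

(* Since a generated sigma-algebra contains the whole space, the product rule
   over the full index set also yields the rule for every subfamily. *)
Definition independent_processes (R : realType) (T : Type)
    (d : measure_display) (Omega : measurableType d) (P : probability Omega R)
    (n : nat) (Y : 'I_n -> T -> Omega -> R) : Prop :=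
  forall A : 'I_n -> set Omega, (forall i, sigma_process (Y i) (A i)) ->
    P (\bigcap_i A i) = (\prod_(i < n) P (A i))%E.

(* The n of the mathematical definition (n >= 1) is n.+1 here.  The independent
   copies may live on any probability space. *)
Definition simple_max_stable (R : realType) (T : Type)
    (d : measure_display) (Omega : measurableType d) (P : probability Omega R)
    (X : T -> {RV P >-> R}) : Prop :=
  (forall (t : T) (x : R), 0 < x ->
     P [set w | X t w <= x] = (expR (- x^-1))%:E) /\
  (forall (n : nat) (d' : measure_display) (Omega' : measurableType d')
          (P' : probability Omega' R) (Y : 'I_n.+1 -> T -> {RV P' >-> R}),
     (forall i, same_fdd P P' (fun t => X t : Omega -> R)
                              (fun t => Y i t : Omega' -> R)) ->
     independent_processes P' (fun i t => Y i t : Omega' -> R) ->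
     same_fdd P' P
       (fun t w => \big[Num.max/Y ord0 t w]_(i < n.+1) Y i t w)
       (fun t w => n.+1%:R * X t w)).
Arguments simple_max_stable {R T d Omega} P X.

(* The inverse is taken in \bar R, where 0^-1 = +oo, and lne 0 = -oo. *)
Definition stable_tail_dep (R : realType) (T : choiceType)
    (d : measure_display) (Omega : measurableType d) (P : probability Omega R)
    (X : T -> {RV P >-> R}) (M : {fset T}) (x : M -> R) : \bar R :=
  (- lne (P [set w | forall t : M, (X (val t) w)%:E <= (x t)%:E^-1]))%E.
Arguments stable_tail_dep {R T d Omega} P X M x.

Definition nonneg_orthant (R : realType) (S : Type) : set (S -> R) :=
  [set y | forall s, 0 <= y s].
Arguments nonneg_orthant {R S} _.

Definition proj_fset (R : realType) (T : choiceType) (M : {fset T})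
    (y : T -> R) : M -> R := fun t => y (val t).
Arguments proj_fset {R T} M y _.

(* Compactness refers to the product topology on S -> R; being compact in
   the orthant or in the whole space is the same for subsets of the orthant. *)
Definition compact_convex_orthant (R : realType) (S : Type)
    (K : set (S -> R)) : Prop :=
  [/\ K `<=` nonneg_orthant,
      compact (K : set {ptws S -> R}) &
      @convex_set R (S -> R^o) K].

Definition is_largest (S : Type) (C : set (set S)) (K : set S) : Prop :=
  C K /\ forall K', C K' -> K' `<=` K.

Definition fdd_dep_candidates (R : realType) (T : choiceType)
    (d : measure_display) (Omega : measurableType d) (P : probability Omega R)
    (X : T -> {RV P >-> R}) (M : {fset T}) : set (set (M -> R)) :=
  [set K | compact_convex_orthant K /\
    forall x : M -> R, nonneg_orthant x ->
      stable_tail_dep P X M x =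
      ereal_sup [set (\sum_(t : M) x t * y t)%:E | y in K]].
Arguments fdd_dep_candidates {R T d Omega} P X M _.

(* A largest element of a family of sets is unique; set0 is the value in case
   there is none, which does not occur for simple max-stable processes. *)
Definition fdd_dep_set (R : realType) (T : choiceType)
    (d : measure_display) (Omega : measurableType d) (P : probability Omega R)
    (X : T -> {RV P >-> R}) (M : {fset T}) : set (M -> R) :=
  xget set0 [set K | is_largest (fdd_dep_candidates P X M) K].
Arguments fdd_dep_set {R T d Omega} P X M _.

Definition dep_set (R : realType) (T : choiceType)
    (d : measure_display) (Omega : measurableType d) (P : probability Omega R)
    (X : T -> {RV P >-> R}) : set (T -> R) :=
  nonneg_orthant `&`
  \bigcap_(M in [set M : {fset T} | M != fset0])
    (proj_fset M @^-1` fdd_dep_set P X M).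
Arguments dep_set {R T d Omega} P X _.

(* Main.v *)
(** For a finite family s write L_s(x) = - log P(x_t X_t <= 1, t in s), so that
    max_t x_t X_t has distribution function u |-> exp (- L_s(x) / u).
    Max-stability, applied to copies on a product space, gives
    L_s(x / n) = L_s(x) / n, hence homogeneity by monotonicity.
    Subadditivity: the number of k <= N exceeded by max_t (x_t + y_t) X_t is at
    most one plus the sum of the numbers exceeded by max_t x_t X_t and by
    max_t y_t X_t; taking expectations and dividing by the harmonic sum H_N ~ log N
    yields L_s(x + y) <= L_s(x) + L_s(y).
    A monotone sublinear function is supported at each point by a nonnegative
    linear form (Hahn-Banach, one coordinate at a time); as L_s(e_t) = 1 the
    coefficients lie in [0, 1], so compactness of [0, 1]^T provides a point of the
    dependency set attaining L_M(x).  Projecting it to [0, oo)^M also shows that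
    the finite-dimensional dependency set K_M is
    the set of all y >= 0 with <x, y> <= L_M(x) for every x >= 0. *)

Require Import Defs.
From HB Require Import structures.
From mathcomp Require Import all_boot all_order all_algebra finmap.
From mathcomp Require Import all_classical all_reals all_analysis.
From mathcomp Require Import measurable_realfun zify ring lra.

Set Implicit Arguments.
Unset Strict Implicit.
Unset Printing Implicit Defensive.

Import Order.TTheory GRing.Theory Num.Theory.
Import numFieldNormedType.Exports.

Local Open Scope classical_set_scope.
Local Open Scope ring_scope.

(** * Sublinear functionals on the orthant and a Hahn-Banach argument *)

Definition sublinear_monotone (R : realType) (S : Type) (p : (S -> R) -> R) :=
  [/\ forall x y, nonneg_orthant x -> nonneg_orthant y -> p (x \+ y) <= p x + p y,
      forall (c : R) x, 0 <= c -> nonneg_orthant x ->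
        p (fun s => c * x s) = c * p x &
      forall x y, nonneg_orthant x -> (forall s, x s <= y s) -> p x <= p y].

(** Linearity in the single direction [u]. Once it holds along all coordinate vectors of a list, [p]
    is linear on their nonnegative combinations. *)
Definition additive_along (R : realType) (S : Type) (p : (S -> R) -> R)
    (u : S -> R) :=
  forall (x : S -> R) (r : R), nonneg_orthant x -> 0 <= r ->
    p (fun s => x s + r * u s) = p x + r * p u.

Lemma nonneg_orthantD (R : realType) (S : Type) (x u : S -> R) (r : R) :
  nonneg_orthant x -> nonneg_orthant u -> 0 <= r ->
  nonneg_orthant (fun s => x s + r * u s).
Proof. by move=> x0 u0 r0 s; rewrite addr_ge0 ?mulr_ge0 ?x0 ?u0. Qed.

Section hahn_banach.
Variables (R : realType) (S : Type).
Implicit Types (p : (S -> R) -> R) (x y u v : S -> R).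

Lemma sublinear_monotone0 p : sublinear_monotone p -> p (fun=> 0) = 0.
Proof.
move=> [_ pZ _]; rewrite -[RHS](mul0r (p (fun=> 0))) -pZ//.
by congr p; apply/funext => s; rewrite mul0r.
Qed.

Lemma additive_along_eq p q u : p (fun=> 0) = 0 -> q (fun=> 0) = 0 ->
  (forall x r, nonneg_orthant x -> 0 <= r ->
     q (fun s => x s + r * u s) = q x + r * p u) ->
  additive_along q u /\ q u = p u.
Proof.
move=> p0 q0 qu; have quE : q u = p u.
  transitivity (q (fun s => 0 + 1 * u s)).
    by congr q; apply/funext => s; rewrite add0r mul1r.
  by rewrite (qu (fun=> 0)) ?q0 ?add0r ?mul1r.
by split=> // x r x0 r0; rewrite quE qu.
Qed.

(** One Hahn-Banach step, done by lowering [p] to q(x) = inf over s >= 0 of p(x + s v) - s p(v). The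
    expression under the infimum is nonincreasing in s, and shifting x by r v only shifts s by r, up
    to the constant r p(v); hence additivity along [v]. The last clause allows the step to be
    iterated without losing earlier directions. *)
Lemma make_additive_along p v : sublinear_monotone p -> nonneg_orthant v ->
  exists q, [/\ sublinear_monotone q,
    forall x, nonneg_orthant x -> q x <= p x,
    additive_along q v /\ q v = p v &
    forall u, nonneg_orthant u -> additive_along p u ->
      additive_along q u /\ q u = p u].
Proof.
move=> sp v0; have p0 := sublinear_monotone0 sp.
case: (sp) => pD pZ pM.
pose G x s := p (fun t => x t + s * v t) - s * p v.
pose q x := inf [set G x s | s in [set s | 0 <= s]].
have G_ge0 x s : nonneg_orthant x -> 0 <= s -> 0 <= G x s.
  move=> x0 s0; rewrite subr_ge0 -pZ//.
  apply: (pM) => [t|t]; first by rewrite mulr_ge0// v0.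
  by rewrite lerDr x0.
have qG x s : nonneg_orthant x -> 0 <= s -> q x <= G x s.
  move=> x0 s0; apply: ge_inf; last by exists s.
  by exists 0 => _ [r r0 <-]; exact: G_ge0.
have le_q x m : (forall s, 0 <= s -> m <= G x s) -> m <= q x.
  move=> mG; apply: lb_le_inf; first by exists (G x 0); exists 0 => /=.
  by move=> _ [s s0 <-]; exact: mG.
have qp x : nonneg_orthant x -> q x <= p x.
  move=> x0; apply: le_trans (qG _ _ x0 (lexx 0)) _.
  rewrite /G mul0r subr0 le_eqVlt; apply/orP; left; apply/eqP; congr p.
  by apply/funext => s; rewrite mul0r addr0.
have q0 : q (fun=> 0) = 0.
  apply/eqP; rewrite eq_le; apply/andP; split.
    by rewrite -[leRHS]p0; exact: qp.
  by apply: (le_q) => s s0; exact: G_ge0.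
have qD x y : nonneg_orthant x -> nonneg_orthant y -> q (x \+ y) <= q x + q y.
  move=> x0 y0; rewrite -lerBlDl; apply: (le_q) => t t0.
  rewrite lerBlDr -lerBlDl; apply: (le_q) => s s0.
  rewrite lerBlDl.
  have xy0 : nonneg_orthant (x \+ y) by move=> r; rewrite addr_ge0 ?x0 ?y0.
  (* The shifts [t] for [y] and [s] for [x] were chosen independently; their sum is an admissible
     shift for the sum of the points. *)
  apply: le_trans (qG _ (t + s) xy0 (addr_ge0 t0 s0)) _.
  have := pD _ _ (nonneg_orthantD y0 v0 t0) (nonneg_orthantD x0 v0 s0).
  rewrite /G [in X in X -> _](_ : _ \+ _ =
    fun r => (x \+ y) r + (t + s) * v r); first by lra.
  by apply/funext => r /=; ring.
have qM x y : nonneg_orthant x -> (forall s, x s <= y s) -> q x <= q y.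
  move=> x0 xy; apply: (le_q) => s s0; apply: le_trans (qG _ _ x0 s0) _.
  rewrite lerB//; apply: (pM); first exact: nonneg_orthantD.
  by move=> t; rewrite lerD2r.
have qZ_le c x : 0 < c -> nonneg_orthant x -> q (fun s => c * x s) <= c * q x.
  move=> c0 x0; rewrite -ler_pdivrMl//; apply: (le_q) => s s0.
  rewrite ler_pdivrMl//.
  have cx0 : nonneg_orthant (fun s => c * x s).
    by move=> t; rewrite mulr_ge0 ?x0// ltW.
  apply: le_trans (qG _ (c * s) cx0 (mulr_ge0 (ltW c0) s0)) _.
  rewrite /G mulrBr -(pZ c) ?(ltW c0)//; last exact: nonneg_orthantD.
  rewrite mulrA lerD2r le_eqVlt; apply/orP; left; apply/eqP; congr p.
  by apply/funext => t; ring.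
have qZ c x : 0 <= c -> nonneg_orthant x -> q (fun s => c * x s) = c * q x.
  rewrite le_eqVlt => /predU1P[<- x0|c0 x0].
    by rewrite mul0r -[RHS]q0; congr q; apply/funext => s; rewrite mul0r.
  apply/eqP; rewrite eq_le qZ_le//= -ler_pdivlMl//.
  have cx0 : nonneg_orthant (fun s => c * x s).
    by move=> t; rewrite mulr_ge0 ?x0// ltW.
  (* The reverse inequality is [qZ_le] for the factor [c^-1] at the point c x. *)
  apply: le_trans (qZ_le c^-1 _ _ cx0); last by rewrite invr_gt0.
  rewrite le_eqVlt; apply/orP; left; apply/eqP; congr q.
  by apply/funext => s; rewrite mulKf// gt_eqF.
exists q; split=> //.
- apply: additive_along_eq => // x r x0 r0; apply/eqP; rewrite eq_le.
  have GE s : G (fun t => x t + r * v t) s = G x (r + s) + r * p v.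
    rewrite /G (_ : (fun t => _ + _) = (fun t => x t + (r + s) * v t)).
      by ring.
    by apply/funext => t; ring.
  apply/andP; split.
    rewrite -lerBlDr; apply: (le_q) => s s0; rewrite lerBlDr.
    apply: le_trans (qG _ s (nonneg_orthantD x0 v0 r0) s0) _.
    rewrite GE lerD2r /G.
    (* What is left is the monotonicity G x (r + s) <= G x s, which is subadditivity of [p] applied
       to x + s v and r v. *)
    have rv0 : nonneg_orthant (fun t => r * v t) by move=> t; rewrite mulr_ge0 ?v0.
    have := pD _ _ (nonneg_orthantD x0 v0 s0) rv0; rewrite pZ//.
    rewrite [in X in X -> _](_ : _ \+ _ =
      fun t => x t + (r + s) * v t); first by lra.
    by apply/funext => t /=; ring.
  apply: (le_q) => s s0; rewrite GE lerD2r.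
  by apply: (qG) => //; rewrite addr_ge0.
- move=> u u0 pu; apply: additive_along_eq => // x r x0 r0.
  have GE s : 0 <= s -> G (fun t => x t + r * u t) s = G x s + r * p u.
    move=> s0; rewrite /G (_ : (fun t => _ + _) =
        (fun t => (x t + s * v t) + r * u t)); last first.
      by apply/funext => t; ring.
    by rewrite pu//; [ring|exact: nonneg_orthantD].
  apply/eqP; rewrite eq_le; apply/andP; split.
    rewrite -lerBlDr; apply: (le_q) => s s0; rewrite lerBlDr -GE//.
    by apply: (qG) => //; exact: nonneg_orthantD.
  by apply: (le_q) => s s0; rewrite GE// lerD2r qG.
Qed.

End hahn_banach.

Definition indic_fun (R : realType) (S : eqType) (t : S) : S -> R :=
  fun s => (s == t)%:R.
Arguments indic_fun {R S} t s.

Lemma indic_fun_ge0 (R : realType) (S : eqType) (t : S) :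
  nonneg_orthant (indic_fun t : S -> R).
Proof. by move=> s; rewrite /indic_fun ler0n. Qed.

(** The last clause carries the induction: a direction once treated stays additive with the same
    value while later coordinates are treated. *)
Lemma make_additive_along_seq (R : realType) (S : eqType) (s : seq S)
    (p : (S -> R) -> R) : sublinear_monotone p ->
  exists q, [/\ sublinear_monotone q,
    forall x, nonneg_orthant x -> q x <= p x,
    forall t, t \in s -> additive_along q (indic_fun t) &
    forall u, nonneg_orthant u -> additive_along p u ->
      additive_along q u /\ q u = p u].
Proof.
elim: s p => [|t s IHs] p sp; first by exists p.
have [q [sq qp [qt _] qu]] := make_additive_along sp (@indic_fun_ge0 R S t).
have [r [sr rq rs ru]] := IHs q sq.
exists r; split=> //.
- by move=> x x0; rewrite (le_trans (rq _ x0))// qp.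
- move=> i; rewrite inE => /predU1P[->|/rs//].
  exact: (ru _ (@indic_fun_ge0 R S t) qt).1.
- move=> u u0 pu; have [qu1 quE] := qu _ u0 pu.
  by have [ru1 ruE] := ru _ u0 qu1; split=> //; rewrite ruE.
Qed.

Lemma sum_additive_along (R : realType) (S : eqType) (s : seq S)
    (q : (S -> R) -> R) (x : S -> R) :
  sublinear_monotone q -> nonneg_orthant x ->
  (forall t, t \in s -> additive_along q (indic_fun t)) ->
  q (fun u => \sum_(t <- s) x t * indic_fun t u) =
  \sum_(t <- s) x t * q (indic_fun t).
Proof.
move=> sq x0; elim: s => [|t s IHs] qs.
  by rewrite big_nil -[RHS](sublinear_monotone0 sq); congr q; apply/funext => u;
    rewrite big_nil.
rewrite big_cons -IHs; last by move=> i si; apply: qs; rewrite inE si orbT.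
rewrite addrC -qs ?mem_head//; last first.
  by move=> u; rewrite sumr_ge0// => i _; rewrite mulr_ge0 ?x0 ?indic_fun_ge0.
by congr q; apply/funext => u; rewrite big_cons addrC.
Qed.

Lemma sum_indic_fun (R : realType) (S : eqType) (s : seq S) (x : S -> R) u :
  uniq s -> \sum_(t <- s) x t * indic_fun t u = if u \in s then x u else 0.
Proof.
move=> us; case: ifPn => su.
  rewrite (bigD1_seq u)//= /indic_fun eqxx mulr1 big1 ?addr0// => t.
  by rewrite eq_sym => /negPf ->; rewrite mulr0.
rewrite big_seq big1// => t ts; rewrite /indic_fun.
case: eqVneq => [ut|]; last by rewrite mulr0.
by rewrite ut ts in su.
Qed.

(** Making [p] additive along [x0] first freezes the value p(x0); making the result additive along
    the coordinate vectors of [s] then yields [r], whose values on these vectors are the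
    coefficients of the supporting form. *)
Lemma supporting_functional (R : realType) (S : eqType) (s : seq S)
    (p : (S -> R) -> R) (x0 : S -> R) :
  uniq s -> sublinear_monotone p -> nonneg_orthant x0 ->
  (forall t, t \notin s -> x0 t = 0) ->
  exists y : S -> R, [/\ nonneg_orthant y,
    forall x, nonneg_orthant x -> \sum_(t <- s) x t * y t <= p x &
    \sum_(t <- s) x0 t * y t = p x0].
Proof.
move=> us sp x00 x0s.
have [q [sq qp [qx0 qx0E] _]] := make_additive_along sp x00.
have [r [sr rq rs ru]] := make_additive_along_seq s sq.
have [_ rx0E] := ru _ x00 qx0; case: (sr) => _ _ rM.
exists (fun t => r (indic_fun t)); split.
- move=> t; rewrite -(sublinear_monotone0 sr).
  by apply: rM => // u; exact: indic_fun_ge0.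
- move=> x xge0; rewrite -sum_additive_along//.
  (* The linear form sees only the restriction of [x] to [s], which lies below [x], so monotonicity
     of [r] takes care of the other coordinates. *)
  apply: le_trans (qp _ xge0); apply: le_trans (rq _ xge0); apply: rM => u.
    by rewrite sum_indic_fun//; case: ifP.
  by rewrite sum_indic_fun//; case: ifP => // _; exact: xge0.
- rewrite -sum_additive_along// -qx0E -rx0E; congr r; apply/funext => u.
  by rewrite sum_indic_fun//; case: ifPn => // /x0s.
Qed.

(** * Independent copies and the scaling of box probabilities *)

(** Iterated binary products: copy 0 is the first projection, the other copies are pulled back along
    the second. The empty family may live on any probability space, here [Omega]. *)
Lemma iid_copies (R : realType) (d : measure_display) (Omega : measurableType d)
    (P : probability Omega R) (n : nat) :
  exists (d' : measure_display) (W' : measurableType d')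
    (P' : probability W' R) (Y : 'I_n -> W' -> Omega),
    (forall i, measurable_fun setT (Y i)) /\
    forall A : 'I_n -> set Omega, (forall i, measurable (A i)) ->
      P' (\bigcap_i (Y i @^-1` A i)) = (\prod_(i < n) P (A i))%E.
Proof.
elim: n => [|n [d' [W' [P' [Y [mY PY]]]]]].
  exists d, Omega, P, (fun _ => id); split=> // A _.
  rewrite big_ord0 (_ : \bigcap_i _ = setT) ?probability_setT//.
  by apply/seteqP; split=> // w _ [].
exists _, (Omega * W')%type, (P \x P')%E,
  (fun i => if unlift ord0 i is Some j then Y j \o snd else fst).
split=> [i|A mA].
  case: unliftP => [j _|_]; last exact: measurable_fst.
  exact: measurableT_comp (mY j) measurable_snd.
rewrite big_ord_recl -PY//.
rewrite (_ : \bigcap_i _ =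
    A ord0 `*` \bigcap_i (Y i @^-1` A (lift ord0 i))); last first.
  apply/seteqP; split=> [[w w'] /= H|[w w'] /= [Aw H] i _].
    split; first by have := H ord0 I; rewrite /= unlift_none.
    by move=> i _; have := H (lift ord0 i) I; rewrite /= liftK.
  by rewrite /preimage/=; case: unliftP => [j ->|->]//; exact: H.
apply: product_measure1E => //; apply: fin_bigcap_measurable => // i _.
by rewrite -[_ @^-1` _]setTI; exact: mY.
Qed.

(** The event that the maximum of x_t X_t over [s] is at most [c]; an empty [s] imposes no
    condition. *)
Definition box (R : realType) (T : eqType) (Omega : Type)
    (X : T -> Omega -> R) (s : seq T) (x : T -> R) (c : R) : set Omega :=
  [set w | forall t, t \in s -> x t * X t w <= c].

Lemma measurable_box (R : realType) (T : eqType) (d : measure_display)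
    (Omega : measurableType d) (P : probability Omega R)
    (X : T -> {RV P >-> R}) (s : seq T) (x : T -> R) (c : R) :
  measurable (box X s x c).
Proof.
rewrite (_ : box X s x c =
  \big[setI/setT]_(t <- s) [set w | x t * X t w <= c]); last first.
  elim: s => [|t s IHs]; first by rewrite big_nil; apply/seteqP; split.
  rewrite big_cons -IHs; apply/seteqP; split=> [w H|w [H1 H2] i] /=.
    by split=> [|i si]; apply: H; rewrite inE ?eqxx ?si ?orbT.
  by rewrite inE => /predU1P[->//|]; exact: H2.
apply: bigsetI_measurable => t _.
rewrite -[X in measurable X]setTI; apply: (measurable_fun_le) => //.
exact: measurable_funM.
Qed.

Section max_stable_scaling.
Variables (R : realType) (T : choiceType) (d : measure_display)
  (Omega : measurableType d) (P : probability Omega R).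
Variables (X : T -> {RV P >-> R}) (hX : simple_max_stable P X).

(** The same event read on the tuple of values, the form to which [same_fdd] applies. *)
Let tuple_box n (s : n.-tuple T) (x : T -> R) (c : R) : set (n.-tuple R) :=
  [set v | forall i, x (tnth s i) * tnth v i <= c].

Let measurable_tuple_box n (s : n.-tuple T) x c : measurable (tuple_box s x c).
Proof.
rewrite (_ : tuple_box s x c =
    \bigcap_i [set v | x (tnth s i) * tnth v i <= c]); last first.
  by apply/seteqP; split=> v /= H i => [_|]; exact: H.
apply: fin_bigcap_measurable => // i _.
rewrite -[X in measurable X]setTI; apply: (measurable_fun_le) => //.
by apply: measurable_funM => //; exact: measurable_tnth.
Qed.

Let tuple_box_mktuple n (s : n.-tuple T) x c (W' : Type)
    (Z : T -> W' -> R) :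
  [set w | tuple_box s x c [tuple Z (tnth s i) w | i < n]] = box Z s x c.
Proof.
apply/seteqP; split=> w /= H.
  by move=> t /tnthP[i ->]; have := H i; rewrite tnth_mktuple.
by move=> i; rewrite tnth_mktuple; apply: H; exact: mem_tnth.
Qed.

(** By independence the left side is the probability that the maximum of n+1 copies satisfies the
    bound n+1; by max-stability the maximum may be replaced by (n+1) X, and the factor cancels. *)
Lemma probability_box_scale (s : seq T) (x : T -> R) (n : nat) :
  nonneg_orthant x ->
  fine (P (box X s x n.+1%:R)) ^+ n.+1 = fine (P (box X s x 1)).
Proof.
move=> x0.
have [d' [W' [P' [Y [mY PY]]]]] := iid_copies P n.+1.
have PYi i A : measurable A -> P' (Y i @^-1` A) = P A.
  move=> mA; have := PY (fun j => if j == i then A else setT).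
  rewrite (_ : \bigcap_j _ = Y i @^-1` A); last first.
    apply/seteqP; split=> w /=; first by move/(_ i I); rewrite /preimage/= eqxx.
    by move=> Aw j _; rewrite /preimage/=; case: eqVneq => [->|].
  move=> ->; last by move=> j; case: ifP.
  rewrite (bigD1 i)//= eqxx big1 ?mule1// => j /negPf ->.
  by rewrite probability_setT.
have mZ i t : (X t \o Y i : W' -> R) \in mfun.
  by rewrite inE; exact: measurableT_comp.
pose Z i t : {RV P' >-> R} := mfun_Sub (mZ i t).
have fddZ i : same_fdd P P' (fun t => X t : Omega -> R)
    (fun t => Z i t : W' -> R).
  move=> m t B mB; rewrite -(PYi i)//.
  rewrite -[X in measurable X]setTI.
  have : measurable_fun setT (fun w => [tuple X (tnth t j) w | j < m]).
    apply/measurable_fun_tnthP => j.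
    rewrite (_ : _ \o _ = X (tnth t j)); first exact: measurable_funPT.
    by apply/funext => w /=; rewrite tnth_mktuple.
  exact.
have indepZ : independent_processes P' (fun i t => Z i t : W' -> R).
  move=> A sA.
  (* Every event generated by copy [i] is a preimage under [Y i], so the product rule of
     [iid_copies] covers it. *)
  have /choice[B AB] i : exists B, measurable B /\ A i = Y i @^-1` B.
    have : (preimage_set_system setT (Y i) measurable) (A i).
      apply: smallest_sub (sA i).
        by apply: sigma_algebra_preimage; exact: sigma_algebra_measurable.
      move=> _ [t [B [mB ->]]]; exists (X t @^-1` B); last by rewrite setTI.
      by rewrite -[X in measurable X]setTI; exact: measurable_funPT.
    by move=> [B mB <-]; exists B; rewrite setTI.
  rewrite (_ : A = fun i => Y i @^-1` B i); last first.
    by apply/funext => i; have [] := AB i.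
  rewrite PY => [|i]; last by have [] := AB i.
  by apply: eq_bigr => i _; rewrite PYi//; have [] := AB i.
have [_ maxX] := hX.
have {maxX} : P' (box (fun t w => \big[Num.max/Z ord0 t w]_(i < n.+1) Z i t w)
    s x n.+1%:R) = P (box (fun t w => n.+1%:R * X t w) s x n.+1%:R).
  rewrite -!(tuple_box_mktuple (in_tuple s)).
  exact: maxX n d' W' P' Z fddZ indepZ _ (in_tuple s) _
    (measurable_tuple_box (in_tuple s) x n.+1%:R).
rewrite (_ : box (fun t w => \big[_/_]_(i < _) _) _ _ _ =
    \bigcap_i (Y i @^-1` box X s x n.+1%:R)); last first.
  apply/seteqP; split=> w H.
    move=> i _ t ts; apply: le_trans (H t ts).
    by rewrite ler_wpM2l ?x0//; exact: (le_bigmax_cond _ (fun i => Z i t w)).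
  move=> t ts; apply: (big_ind (fun m => x t * m <= n.+1%:R)).
  - exact: H.
  - by move=> a b Ha Hb; rewrite maxEle; case: ifP.
  - by move=> i _; exact: H.
rewrite PY => [|i]; last exact: measurable_box.
rewrite -[P _ in LHS]fineK ?fin_num_measure//; last exact: measurable_box.
rewrite prodEFin prodr_const card_ord => PE; rewrite -[LHS]/(fine _%:E) PE.
congr (fine (P _)).
have boxE t w : (x t * (n.+1%:R * X t w) <= n.+1%:R) = (x t * X t w <= 1).
  by rewrite mulrCA -[leRHS]mulr1 ler_pM2l.
by apply/seteqP; split=> w H t ts; have := H t ts; rewrite boxE.
Qed.
End max_stable_scaling.

(** * Counting exceedances and comparison of harmonic sums *)

(** Both sides are integrals of counting functions, which are compared pointwise. *)
Lemma sum_measure_le (R : realType) (d : measure_display)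
    (Omega : measurableType d) (P : {measure set Omega -> \bar R})
    (I J : Type) (r : seq I) (s : seq J) (A : I -> set Omega) (B : J -> set Omega) :
  (forall i, measurable (A i)) -> (forall j, measurable (B j)) ->
  (forall w, \sum_(i <- r) \1_(A i) w <= \sum_(j <- s) \1_(B j) w :> R) ->
  (\sum_(i <- r) P (A i) <= \sum_(j <- s) P (B j))%E.
Proof.
move=> mA mB AB.
have sumE (K : Type) (q : seq K) (C : K -> set Omega) :
    (forall k, measurable (C k)) ->
    (\sum_(k <- q) P (C k) = \int[P]_w (\sum_(k <- q) \1_(C k) w)%:E)%E.
  move=> mC; under [RHS]eq_integral do rewrite -sumEFin.
  rewrite ge0_integral_sum//.
  - by apply: eq_bigr => k _; rewrite integral_indic// setIT.
  - by move=> k; apply/measurable_EFinP; exact: measurable_indic.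
rewrite !sumE//; apply: ge0_le_integral => //.
- by move=> w _; rewrite lee_fin sumr_ge0// => i _; rewrite indicE.
- by apply/measurable_EFinP; apply: measurable_sum => i; exact: measurable_indic.
- by apply/measurable_EFinP; apply: measurable_sum => i; exact: measurable_indic.
- by move=> w _; rewrite lee_fin; exact: AB.
Qed.

(** An antitone predicate holds on an initial segment, so its count, when below [N], is itself an
    index of failure. If the counts i of [b] and j of [c] are below [N], then [a] fails at i+j+1,
    which bounds its count; otherwise the right side is at least [N]. Index k stands for level k+1,
    and (i+1) + (j+1) is the level of index i+j+1. *)
Lemma count_antitone_le (a b c : nat -> bool) (N : nat) :
  (forall i j, (i <= j)%N -> a j -> a i) ->
  (forall i j, (i <= j)%N -> b j -> b i) ->
  (forall i j, (i <= j)%N -> c j -> c i) ->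
  (forall i j, ~~ b i -> ~~ c j -> ~~ a (i + j).+1) ->
  (\sum_(k < N) a k <= \sum_(k < N) b k + \sum_(k < N) c k + 1)%N.
Proof.
have le_count (u : nat -> bool) (m : nat) :
    (forall i j, (i <= j)%N -> u j -> u i) -> ~~ u m ->
    (\sum_(k < N) u k <= m)%N.
  move=> uW um; apply: (@leq_trans (\sum_(k < N) (k < m))%N).
    apply: leq_sum => k _; case: ltnP => // mk; first by case: (u k).
    by rewrite leqn0 eqb0; apply: contra um; exact: uW.
  apply: (@leq_trans (minn N m)); last exact: geq_minr.
  elim: (N) => [|M IHM]; first by rewrite big_ord0.
  rewrite big_ord_recr/=; move: IHM; set S := (\sum_(k < M) _)%N.
  by case: (ltnP M m) => /=; lia.
have not_count (u : nat -> bool) : (forall i j, (i <= j)%N -> u j -> u i) ->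
    (\sum_(k < N) u k < N)%N -> ~~ u (\sum_(k < N) u k)%N.
  move=> uW; apply: contraL; set m := (\sum_(k < N) u k)%N => um.
  (* If [u m] held, every index up to [m] and below [N] would be counted, giving min(N, m+1) <= m
     and hence N <= m. *)
  suff : (minn N m.+1 <= m)%N by lia.
  rewrite {2}/m; elim: (N) => [|M IHM]; first by rewrite big_ord0 min0n.
  rewrite big_ord_recr/=; move: IHM; set S := (\sum_(k < M) _)%N.
  have [Mm|mM] := leqP M m; last by lia.
  by rewrite (uW _ _ Mm um)/=; lia.
have count_le (u : nat -> bool) : (\sum_(k < N) u k <= N)%N.
  by rewrite -[leqRHS]card_ord -sum1_card leq_sum// => k _; case: (u k).
move=> aW bW cW abc.
have [/(not_count _ bW) nb|Nb] := ltnP (\sum_(k < N) b k)%N N; last first.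
  by rewrite -addnA (leq_trans (count_le a))// (leq_trans Nb)// leq_addr.
have [/(not_count _ cW) nc|Nc] := ltnP (\sum_(k < N) c k)%N N; last first.
  rewrite addnAC (leq_trans (count_le a))// (leq_trans Nc)// leq_addl//.
by rewrite addn1; apply: le_count => //; exact: abc.
Qed.

(** Telescoping with 1/(n+1)^2 <= 1/n - 1/(n+1). For N = 0 the convention 0^-1 = 0 turns the bound
    into 2. *)
Lemma sum_inv_sqr_le (R : realFieldType) (N : nat) :
  \sum_(k < N) (k.+1%:R ^- 2) <= 2 - N%:R^-1 :> R.
Proof.
case: N => [|N]; first by rewrite big_ord0 invr0 subr0.
elim: N => [|N IHN]; first by rewrite big_ord1 expr1n !invr1 lerBrDr; exact: lexx.
rewrite big_ord_recr/=; apply: le_trans (lerD IHN (lexx _)) _.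
rewrite -(natr1 N.+1); set n : R := N.+1%:R; have n0 : 0 < n by rewrite ltr0n.
suff : (n + 1) ^- 2 <= n^-1 - (n + 1)^-1.
  by move: (n^-1) ((n + 1)^-1) ((n + 1) ^- 2) => a b e; lra.
have -> : n^-1 - (n + 1)^-1 = (n * (n + 1))^-1.
  by field; rewrite !gt_eqF//; lra.
rewrite lef_pV2 ?posrE ?exprn_gt0 ?mulr_gt0//; [|lra..].
by rewrite expr2 ler_pM2r; lra.
Qed.

Lemma harmonic_sum_unbounded (R : realType) (c : R) :
  exists N, c < \sum_(k < N) k.+1%:R^-1.
Proof.
apply: contrapT => /forallNP Hc; apply: (@dvg_harmonic R).
apply: nondecreasing_is_cvgn.
  apply/nondecreasing_seqP => n; rewrite !seriesEnat/= big_nat_recr//=.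
  by rewrite lerDl.
exists c => _ [n _ <-]; rewrite seriesEord/= leNgt; apply/negP; exact: Hc.
Qed.

(* For each u in {a, b, c}, the sum is asymptotic to u log N. *)
Lemma le_add_of_frechet_sums (R : realType) (a b c : R) : 0 <= c ->
  (forall N, \sum_(k < N) (1 - expR (- (c / k.+1%:R))) <=
    \sum_(k < N) (1 - expR (- (a / k.+1%:R))) +
    \sum_(k < N) (1 - expR (- (b / k.+1%:R))) + 1) ->
  c <= a + b.
Proof.
move=> c0 H; rewrite leNgt; apply/negP => abc.
(* Write H_N for the harmonic sum. Since 1 - exp(-u) <= u for all u, 1 - exp(-u) >= u - u^2 for u >=
   0, and the inverse squares sum to at most 2, the hypothesis forces (c - a - b) H_N <= 1 + 2 c^2.
   The chosen [N] violates this. *)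
have [N] := harmonic_sum_unbounded ((1 + 2 * c ^+ 2) / (c - (a + b))).
rewrite ltr_pdivrMr ?subr_gt0//; apply/negP; rewrite -leNgt.
have upper (u : R) : \sum_(k < N) (1 - expR (- (u / k.+1%:R))) <=
    u * \sum_(k < N) k.+1%:R^-1.
  rewrite mulr_sumr; apply: ler_sum => k _.
  by rewrite lerBlDr -lerBlDl expR_ge1Dx.
have lower : c * (\sum_(k < N) k.+1%:R^-1) - c ^+ 2 * \sum_(k < N) k.+1%:R ^- 2
    <= \sum_(k < N) (1 - expR (- (c / k.+1%:R))).
  rewrite !mulr_sumr -sumrB; apply: ler_sum => k _.
  rewrite -exprVn -exprMn expRN.
  set u := c * _; have u0 : 0 <= u by rewrite mulr_ge0.
  clearbody u.
  have : (expR u)^-1 <= (1 + u)^-1.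
    by rewrite lef_pV2 ?posrE ?expR_gt0 ?expR_ge1Dx//; lra.
  suff : (1 + u)^-1 <= 1 - u + u ^+ 2.
    by rewrite lerBrDr -lerBrDl => le_quad /le_trans; apply; lra.
  have u1 : 0 < 1 + u by rewrite ltr_pwDl.
  rewrite -[leLHS]mul1r ler_pdivrMr//.
  have u3 : 0 <= u ^+ 3 by rewrite exprn_ge0.
  by rewrite (_ : _ * _ = 1 + u ^+ 3); [lra|ring].
have := H N; have := upper a; have := upper b.
have : c ^+ 2 * \sum_(k < N) (k.+1%:R ^- 2) <= c ^+ 2 * 2.
  rewrite ler_wpM2l ?sqr_ge0//; apply: le_trans (sum_inv_sqr_le _ _) _.
  by rewrite gerBl.
by nra.
Qed.

(** * The stable tail dependence function is monotone and sublinear *)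

(** The real-valued L_s, with weights on all of [T] so that different families can be compared. That
    the logarithm is taken of a positive number is [probability_box_gt0]. *)
Definition tail_dep (R : realType) (T : eqType) (d : measure_display)
    (Omega : measurableType d) (P : probability Omega R)
    (X : T -> Omega -> R) (s : seq T) (x : T -> R) : R :=
  - ln (fine (P (box X s x 1))).

Lemma box_scale (R : realType) (T : eqType) (Omega : Type)
    (X : T -> Omega -> R) (s : seq T) (x : T -> R) (c : R) : 0 < c ->
  box X s (fun t => x t / c) 1 = box X s x c.
Proof.
move=> c0; have boxE t w : (x t / c * X t w <= 1) = (x t * X t w <= c).
  by rewrite mulrAC ler_pdivrMr// mul1r.
by apply/seteqP; split=> w H t ts; have := H t ts; rewrite boxE.
Qed.

Lemma box_restrict (R : realType) (T : eqType) (Omega : Type)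
    (X : T -> Omega -> R) (s s' : seq T) (x : T -> R) (c : R) : 0 <= c ->
  {subset s <= s'} ->
  box X s' (fun t => if t \in s then x t else 0) c = box X s x c.
Proof.
move=> c0 ss'; apply/seteqP; split=> w H t ts.
  by have := H t (ss' t ts); rewrite ts.
by case: ifPn => [/H//|_]; rewrite mul0r.
Qed.

Lemma box_le (R : realType) (T : eqType) (Omega : Type)
    (X : T -> Omega -> R) (s : seq T) (x y : T -> R) (c : R) : 0 <= c ->
  nonneg_orthant x -> (forall t, x t <= y t) -> box X s y c `<=` box X s x c.
Proof.
move=> c0 x0 xy w H t ts; have [X0|X0] := leP 0 (X t w).
  by apply: le_trans (H t ts); rewrite ler_wpM2r.
(* Where [X t] is negative the product is nonpositive, and 0 <= c suffices. *)
by apply: le_trans c0; rewrite mulr_ge0_le0 ?x0// ltW.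
Qed.

Lemma box_widen (R : realType) (T : eqType) (Omega : Type)
    (X : T -> Omega -> R) (s : seq T) (x : T -> R) (c c' : R) : c <= c' ->
  box X s x c `<=` box X s x c'.
Proof. by move=> cc' w H t ts; exact: le_trans (H t ts) cc'. Qed.

Lemma box_add (R : realType) (T : eqType) (Omega : Type)
    (X : T -> Omega -> R) (s : seq T) (x y : T -> R) (a b : R) :
  box X s x a `&` box X s y b `<=` box X s (x \+ y) (a + b).
Proof. by move=> w [Hx Hy] t ts; rewrite mulrDl lerD ?Hx ?Hy. Qed.

Lemma le_of_le_div_nat (R : archiRealFieldType) (a b c : R) :
  (forall n, a <= b + c / n.+1%:R) -> a <= b.
Proof.
move=> H; rewrite leNgt; apply/negP => ba.
have ab0 : 0 < a - b by rewrite subr_gt0.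
have := truncnS_gt (c / (a - b)); rewrite ltr_pdivrMr// => cn.
have := H (Num.truncn (c / (a - b))).
by rewrite -lerBlDl ler_pdivlMr ?ltr0n// leNgt mulrC cn.
Qed.

Section tail_dep_sublinear.
Variables (R : realType) (T : choiceType) (d : measure_display)
  (Omega : measurableType d) (P : probability Omega R).
Variables (X : T -> {RV P >-> R}) (hX : simple_max_stable P X).
Implicit Types (s : seq T) (x y : T -> R).

Local Notation mbox := (measurable_box X).
Local Notation L := (tail_dep P X).

Lemma probability_margin (a c : R) t : 0 <= a -> 0 < c ->
  P [set w | a * X t w <= c] = (expR (- (a / c)))%:E.
Proof.
rewrite le_eqVlt => /predU1P[<-|a0] c0.
  rewrite mul0r oppr0 expR0 (_ : [set _ | _] = setT) ?probability_setT//.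
  by apply/seteqP; split=> w //= _; rewrite mul0r ltW.
have [/(_ t (c / a) (divr_gt0 c0 a0)) + _] := hX.
rewrite invf_div => <-; congr (P _); apply/seteqP; split=> w /=;
  by rewrite ler_pdivlMr// mulrC.
Qed.

(** Union bound over the Fréchet margins, with 1 - exp(-u) <= u. *)
Lemma probability_boxC_le s x c : nonneg_orthant x -> 0 < c ->
  (P (~` box X s x c) <= ((\sum_(t <- s) x t) / c)%:E)%E.
Proof.
move=> x0 c0; elim: s => [|t s IHs].
  rewrite big_nil mul0r (_ : box _ _ _ _ = setT) ?setCT ?measure0//.
  by apply/seteqP; split.
have mt : measurable [set w | x t * X t w <= c].
  rewrite (_ : [set _ | _] = box X [:: t] x c); first exact: mbox.
  apply/seteqP; split=> w /=; first by move=> H i; rewrite inE => /eqP ->.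
  by apply; rewrite inE.
rewrite (_ : box _ _ _ _ = [set w | x t * X t w <= c] `&` box X s x c).
  have : (P (~` [set w | (x t * X t w <= c)%R] `|` ~` box X s x c) <=
      P (~` [set w | (x t * X t w <= c)%R]) + P (~` box X s x c))%E.
    by apply: measureU2; apply: measurableC => //; exact: mbox.
  rewrite setCI => /le_trans; apply.
  rewrite big_cons mulrDl EFinD; apply: leeD => //.
  rewrite probability_setC// probability_margin// -EFinB lee_fin.
  by rewrite lerBlDr -lerBlDl expR_ge1Dx.
apply/seteqP; split=> [w H|w [H1 H2] i].
  by split=> [|i si]; apply: H; rewrite inE ?eqxx ?si ?orbT.
by rewrite inE => /predU1P[->//|]; exact: H2.
Qed.

Lemma fine_probability_box s x c : ((fine (P (box X s x c)))%:E = P (box X s x c))%E.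
Proof. by rewrite fineK// fin_num_measure//; exact: mbox. Qed.

(** At an integer level above the sum of the weights the union bound leaves positive probability;
    the scaling identity brings this down to level 1. *)
Lemma probability_box_gt0 s x : nonneg_orthant x ->
  0 < fine (P (box X s x 1)).
Proof.
move=> x0; set S := \sum_(t <- s) x t.
set n := Num.truncn S; rewrite -(probability_box_scale hX s n x0).
rewrite exprn_gt0// -lte_fin fine_probability_box.
have := probability_boxC_le s x0 (ltr0Sn R n).
rewrite probability_setC; last exact: mbox.
rewrite -/S -fine_probability_box -EFinB lee_fin lte_fin lerBlDr -lerBlDl.
apply: lt_le_trans; rewrite subr_gt0 ltr_pdivrMr// mul1r.
exact: truncnS_gt.
Qed.

(** Both sides are nonnegative and have the same (k+1)-th power, by [probability_box_scale]. *)
Lemma probability_boxE s x k : nonneg_orthant x ->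
  P (box X s x k.+1%:R) = (expR (- (L s x / k.+1%:R)))%:E.
Proof.
move=> x0; rewrite -fine_probability_box; congr EFin.
apply: (@pexpIrn _ k.+1) => //; rewrite ?nnegrE ?fine_ge0 ?expR_ge0//.
rewrite probability_box_scale// -expRM_natl mulrN mulrC divfK//.
by rewrite /tail_dep opprK lnK// posrE probability_box_gt0.
Qed.

Lemma tail_dep_div s x k : nonneg_orthant x ->
  L s (fun t => x t / k.+1%:R) = L s x / k.+1%:R.
Proof.
by move=> x0; rewrite {1}/tail_dep box_scale// probability_boxE//= expRK opprK.
Qed.

Lemma tail_dep_le s x y : nonneg_orthant x -> (forall t, x t <= y t) ->
  L s x <= L s y.
Proof.
move=> x0 xy; have y0 t : 0 <= y t by apply: le_trans (xy t); exact: x0.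
rewrite lerN2 ler_ln ?posrE ?probability_box_gt0//.
rewrite -lee_fin !fine_probability_box le_measure ?inE//; try exact: mbox.
exact: box_le.
Qed.

Lemma tail_dep_indic s t : t \in s -> L s (indic_fun t) = 1.
Proof.
move=> ts; rewrite /tail_dep (_ : box _ _ _ _ = [set w | 1 * X t w <= 1]).
  by rewrite probability_margin//= divr1 expRK opprK.
apply/seteqP; split=> w /=.
  by move/(_ t ts); rewrite /indic_fun eqxx.
move=> H i _; rewrite /indic_fun; case: eqVneq => [->//|_].
by rewrite mul0r.
Qed.

Lemma tail_dep_ge0 s x : nonneg_orthant x -> 0 <= L s x.
Proof.
move=> x0; rewrite oppr_ge0 ln_le0// -lee_fin fine_probability_box.
by apply: probability_le1; exact: mbox.
Qed.

Lemma tail_depD s x y : nonneg_orthant x -> nonneg_orthant y ->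
  L s (x \+ y) <= L s x + L s y.
Proof.
move=> x0 y0; have xy0 : nonneg_orthant (x \+ y).
  by move=> t; rewrite addr_ge0 ?x0 ?y0.
apply: le_add_of_frechet_sums => [|N]; first exact: tail_dep_ge0.
(* [A z k] is the event that the maximum of z_t X_t exceeds level k+1; summing its probabilities
   over k gives the expected number of levels exceeded. *)
pose A z (k : nat) := ~` box X s z k.+1%:R.
have mA z k : measurable (A z k) by apply: measurableC; exact: mbox.
have PA z k : nonneg_orthant z ->
    P (A z k) = (1 - expR (- (L s z / k.+1%:R)))%:E.
  move=> z0; rewrite probability_setC; last exact: mbox.
  by rewrite probability_boxE.
have AW z w i j : (i <= j)%N -> w \in A z j -> w \in A z i.
  move=> ij; rewrite !inE; apply: contra_not; apply: box_widen.
  by rewrite ler_nat.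
have countA w : (\sum_(k < N) (w \in A (x \+ y) k) <=
    \sum_(k < N) (w \in A x k) + \sum_(k < N) (w \in A y k) + 1)%N.
  apply: (@count_antitone_le (fun k => w \in A (x \+ y) k)
    (fun k => w \in A x k) (fun k => w \in A y k)); [exact: AW..|].
  move=> i j /negP; rewrite inE => /contrapT Ai /negP; rewrite inE => /contrapT Aj.
  apply/negP; rewrite inE; apply.
  have -> : (i + j).+2%:R = i.+1%:R + j.+1%:R :> R by rewrite -natrD addSn addnS.
  exact: box_add.
(* The [unit] summand, with the whole space as its event, supplies the additive 1 of the counting
   bound. *)
pose B (k : 'I_N + ('I_N + unit)) := match k with
  | inl k => A x k | inr (inl k) => A y k | inr (inr _) => setT end.
have mB k : measurable (B k) by case: k => [k|[k|[]]] //=.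
have /(sum_measure_le P (fun k : 'I_N => mA (x \+ y) k) mB) : forall w,
    \sum_(k <- index_enum 'I_N) \1_(A (x \+ y) k) w <=
    \sum_(k <- index_enum ('I_N + ('I_N + unit))%type) \1_(B k) w :> R.
  move=> w; rewrite !big_sumType/=.
  rewrite (big_pred1 tt)/=; last by case.
  rewrite indicE in_setT.
  under eq_bigr do rewrite indicE.
  under [X in _ <= X + _]eq_bigr do rewrite indicE.
  under [X in _ <= _ + (X + _)]eq_bigr do rewrite indicE.
  by rewrite -!natr_sum -!natrD ler_nat addnA countA.
rewrite !big_sumType/= (big_pred1 tt)/=; last by case.
rewrite probability_setT.
under eq_bigr do rewrite PA//.
under [X in (_ <= X + _)%E]eq_bigr do rewrite PA//.
under [X in (_ <= _ + (X + _))%E]eq_bigr do rewrite PA//.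
by rewrite !sumEFin -!EFinD lee_fin addrA.
Qed.

Lemma tail_depZ_nat s x n : nonneg_orthant x ->
  L s (fun t => n%:R * x t) = n%:R * L s x.
Proof.
move=> x0; case: n => [|n].
  rewrite mul0r /tail_dep (_ : box _ _ _ _ = setT).
    by rewrite probability_setT/= ln1 oppr0.
  by apply/seteqP; split=> // w _ t _; rewrite !mul0r.
have nx0 : nonneg_orthant (fun t => n.+1%:R * x t).
  by move=> t; rewrite mulr_ge0 ?x0.
rewrite -[X in _ = _ * L s X](_ : (fun t => n.+1%:R * x t / n.+1%:R) = x).
  by rewrite tail_dep_div// mulrC divfK.
by apply/funext => t; rewrite mulrC mulKf.
Qed.

(** With m the integer part of c (n+1), monotonicity and integer homogeneity place (n+1) L(c x)
    between m L(x) and (m+1) L(x). Dividing by n+1 leaves an error of at most L(x)/(n+1) on either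
    side. *)
Lemma tail_depZ (c : R) s x : 0 <= c -> nonneg_orthant x ->
  L s (fun t => c * x t) = c * L s x.
Proof.
move=> c0 x0.
have scale n m : m%:R <= c * n.+1%:R < m.+1%:R ->
    m%:R * L s x <= n.+1%:R * L s (fun t => c * x t) <= m.+1%:R * L s x.
  move=> /andP[mc cm].
  have cx0 : nonneg_orthant (fun t => c * x t) by move=> t; rewrite mulr_ge0 ?x0.
  rewrite -!tail_depZ_nat//; apply/andP; split; apply: tail_dep_le => t.
  - by rewrite mulr_ge0 ?x0.
  - by rewrite mulrA (mulrC _ c) ler_wpM2r ?x0.
  - by rewrite mulr_ge0 ?cx0.
  - by rewrite mulrA (mulrC _ c) ler_wpM2r ?x0// ltW.
have {}scale n : exists2 m : nat, m%:R <= c * n.+1%:R < m%:R + 1 &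
    m%:R * L s x <= n.+1%:R * L s (fun t => c * x t) <= (m%:R + 1) * L s x.
  exists (Num.truncn (c * n.+1%:R)).
    by rewrite natr1 truncn_itv// mulr_ge0.
  by rewrite natr1 scale// truncn_itv// mulr_ge0.
have L0 := tail_dep_ge0 s x0.
apply/eqP; rewrite eq_le; apply/andP; split;
  apply: (@le_of_le_div_nat _ _ _ (L s x)) => n;
  have [m /andP[mc cm] /andP[mL Lm]] := scale n;
  rewrite -(@ler_pM2l _ n.+1%:R)// mulrDr [X in _ + X]mulrCA divff// mulr1.
  apply: (le_trans Lm); rewrite mulrDl mul1r lerD2r mulrA.
  by rewrite ler_wpM2r// mulrC.
rewrite mulrA (mulrC _ c); apply: (@le_trans _ _ ((m%:R + 1) * L s x)).
  by rewrite ler_wpM2r// ltW.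
by rewrite mulrDl mul1r lerD2r.
Qed.

Lemma tail_dep_sublinear s : sublinear_monotone (L s).
Proof.
split; [exact: tail_depD| |exact: tail_dep_le].
by move=> c x c0 x0; rewrite tail_depZ.
Qed.

End tail_dep_sublinear.

(** * Closed half-spaces and compactness in the product topology *)

Section halfspaces.
Variables (R : realType) (S : choiceType).
Implicit Types (s : seq S) (x : S -> R).

Lemma continuous_sum_coord s x :
  continuous (fun y : {ptws S -> R} => \sum_(t <- s) x t * y t).
Proof.
elim: s => [|t s IHs].
  rewrite (_ : (fun y : {ptws S -> R} => _) = fun=> 0); first exact: cst_continuous.
  by apply/funext => y; rewrite big_nil.
rewrite (_ : (fun y : {ptws S -> R} => _) =
    fun y : {ptws S -> R} => x t * y t + \sum_(u <- s) x u * y u); last first.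
  by apply/funext => y; rewrite big_cons.
move=> y.
have prt : {for y, continuous (fun z : {ptws S -> R} => z t)}.
  exact: (@proj_continuous S (fun=> R) t y).
have cx : {for y, continuous (fun _ : {ptws S -> R} => x t)}.
  exact: cst_continuous.
exact: (@continuousD R R {ptws S -> R} _ _ y (continuousM cx prt) (IHs y)).
Qed.

Lemma closed_halfspace s x (b : R) :
  closed [set y : {ptws S -> R} | \sum_(t <- s) x t * y t <= b].
Proof.
apply: (@preimage_closed {ptws S -> R} R _ [set z | z <= b]).
  by move=> y _; exact: continuous_sum_coord.
exact: closed_le.
Qed.

Lemma closed_hyperplane s x (b : R) :
  closed [set y : {ptws S -> R} | \sum_(t <- s) x t * y t = b].
Proof.
apply: (@preimage_closed {ptws S -> R} R _ [set z | z = b]).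
  by move=> y _; exact: continuous_sum_coord.
exact: closed_eq.
Qed.

Lemma compact_cube : compact ([set y | forall t, 0 <= y t <= 1] : set {ptws S -> R}).
Proof.
rewrite (_ : [set y | _] = [set y : S -> R | forall t, `[0, 1]%classic (y t)]).
  exact: (@tychonoff S (fun=> R) (fun=> `[0, 1]%classic)
    (fun=> @segment_compact R 0 1)).
by apply/seteqP; split=> y /= H t; have := H t; rewrite in_itv.
Qed.

Lemma closed_nonneg_orthant : closed (nonneg_orthant : set {ptws S -> R}).
Proof.
rewrite (_ : nonneg_orthant = \bigcap_t [set y : {ptws S -> R} |
    \sum_(u <- [:: t]) -1 * y u <= 0]).
  by apply: closed_bigI => t _; exact: closed_halfspace.
apply/seteqP; split=> y H t; first by move=> _ /=; rewrite big_seq1 mulN1r oppr_le0.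
by have := H t I; rewrite /= big_seq1 mulN1r oppr_le0.
Qed.

(** The bound by 1 makes the set a closed part of the Tychonoff cube. The index type is arbitrary so
    that the lemma serves both the finite-dimensional bodies and the body of the whole process. *)
Lemma compact_convex_halfspaces (I : Type) (D : set I) (s : I -> seq S)
    (x : I -> S -> R) (b : I -> R)
    (K := nonneg_orthant `&`
      \bigcap_(i in D) [set y | \sum_(t <- s i) x i t * y t <= b i]) :
  (forall y t, K y -> y t <= 1) -> compact_convex_orthant K.
Proof.
move=> K1; split; first by move=> y [].
- apply: (@subclosed_compact {ptws S -> R} _ _ _ compact_cube).
    apply: closedI; first exact: closed_nonneg_orthant.
    by apply: closed_bigI => i _; exact: closed_halfspace.
  by move=> y Ky t; rewrite K1// andbT; case: Ky.
- move=> y z l; rewrite !inE => -[y0 Ky] [z0 Kz].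
  set w := (X in K X).
  have c0 : 0 <= l%:inum :> R by [].
  have c1 : l%:inum <= 1 :> R by [].
  move: c0 c1; set c : R := l%:inum; rewrite -(subr_ge0 c) => c0 c1.
  have wE t : w t = c * y t + (1 - c) * z t by [].
  split=> [t|i Di]; first by rewrite wE addr_ge0// mulr_ge0.
  rewrite /= (_ : \sum_(t <- s i) _ =
      c * (\sum_(t <- s i) x i t * y t) +
      (1 - c) * (\sum_(t <- s i) x i t * z t)).
    have := ler_wpM2l c0 (Ky i Di); have := ler_wpM2l c1 (Kz i Di).
    rewrite /=; lra.
  rewrite !mulr_sumr -big_split/=; apply: eq_bigr => t _.
  by rewrite wE mulrDr; congr (_ + _); rewrite mulrCA.
Qed.

End halfspaces.

(** * The dependency sets as intersections of half-spaces *)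

Lemma ereal_sup_max (R : realType) (A : set \bar R) (a : \bar R) :
  A a -> ubound A a -> ereal_sup A = a.
Proof.
by move=> Aa ubA; apply/eqP; rewrite eq_le ge_ereal_sup ?ereal_sup_ubound.
Qed.

Lemma is_largest_unique (S : Type) (C : set (set S)) (K K' : set S) :
  is_largest C K -> is_largest C K' -> K = K'.
Proof. by move=> [CK KC] [CK' KC']; apply/seteqP; split; auto. Qed.

Definition extend0 (R : realType) (T : choiceType) (M : {fset T})
    (x : M -> R) : T -> R := fun t => oapp x 0 (insub t).

Lemma extend0_val (R : realType) (T : choiceType) (M : {fset T}) (x : M -> R)
  (t : M) : extend0 x (val t) = x t.
Proof. by rewrite /extend0 valK. Qed.

Lemma extend0_out (R : realType) (T : choiceType) (M : {fset T}) (x : M -> R) t :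
  t \notin M -> extend0 x t = 0.
Proof. by move=> tM; rewrite /extend0 insubN. Qed.

Lemma extend0_ge0 (R : realType) (T : choiceType) (M : {fset T}) (x : M -> R) :
  nonneg_orthant x -> nonneg_orthant (extend0 x).
Proof. by move=> x0 t; rewrite /extend0; case: insub => /=. Qed.

Section dependency_set.
Variables (R : realType) (T : choiceType) (d : measure_display)
  (Omega : measurableType d) (P : probability Omega R).
Variables (X : T -> {RV P >-> R}) (hX : simple_max_stable P X).
Implicit Types (M : {fset T}) (y : T -> R).

Local Notation L := (tail_dep P X).

Lemma tail_dep_restrict (s s' : seq T) (x : T -> R) : {subset s <= s'} ->
  L s' (fun t => if t \in s then x t else 0) = L s x.
Proof.
by move=> ss'; rewrite /tail_dep box_restrict.
Qed.

Lemma stable_tail_depE M (x : M -> R) : nonneg_orthant x ->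
  stable_tail_dep P X M x = (L M (extend0 x))%:E.
Proof.
move=> x0; rewrite /stable_tail_dep (_ : [set w | _] = box X M (extend0 x) 1).
  rewrite -fine_probability_box lne_EFin//.
  by apply: (probability_box_gt0 hX); exact: extend0_ge0.
have coordE (t : M) w : ((X (val t) w)%:E <= (x t)%:E^-1)%E =
    (x t * X (val t) w <= 1).
  (* A zero weight imposes nothing on either side: the bound is +oo on the left, and the right reads
     0 <= 1. *)
  have [xt0|xt0] := eqVneq (x t) 0; first by rewrite xt0 inve0 leey mul0r ler01.
  have xt : 0 < x t by rewrite lt_neqAle eq_sym xt0 x0.
  by rewrite inver (negPf xt0) lee_fin -[in LHS](mulr1 (x t)^-1) ler_pdivlMl.
apply/seteqP; split=> w H t.
  by move=> tM; have := H [` tM]%fset; rewrite coordE -(extend0_val x).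
by rewrite coordE -(extend0_val x); apply: H; exact: valP.
Qed.

Lemma sum_extend0 M (x : M -> R) y :
  \sum_(t : M) x t * y (val t) = \sum_(t <- M) extend0 x t * y t.
Proof.
by rewrite big_seq_fsetE; apply: eq_bigr => t _; rewrite extend0_val.
Qed.

Definition dominated M : set (T -> R) := [set y | forall x, nonneg_orthant x ->
  \sum_(t <- M) x t * y t <= L M x].

Lemma dominated_le1 y :
  nonneg_orthant y -> (forall M, M != fset0 -> dominated M y) -> forall t, y t <= 1.
Proof.
move=> y0 yb t; have t1 : [fset t]%fset != fset0.
  by apply/fset0Pn; exists t; rewrite inE.
have := yb _ t1 _ (@indic_fun_ge0 R T t).
rewrite big_seq_fset1 (tail_dep_indic hX) ?inE// /indic_fun eqxx.
by rewrite mul1r.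
Qed.

(** Finite stage of the compactness argument: a supporting form of L_U, extended by zero outside
    [U]. Restricting weights to a subset M of [U] turns L_U into L_M, so all smaller families are
    dominated at once. *)
Lemma supporting_point_fset (U M0 : {fset T}) (x0 : T -> R) : (M0 `<=` U)%fset ->
  nonneg_orthant x0 -> (forall t, t \notin M0 -> x0 t = 0) ->
  exists y, [/\ forall t, 0 <= y t <= 1,
    forall M, (M `<=` U)%fset -> dominated M y &
    \sum_(t <- M0) x0 t * y t = L M0 x0].
Proof.
move=> M0U x00 x0M.
have [|y [y0 yU yx0]] := @supporting_functional R T U (L U) x0 (fset_uniq U)
  (tail_dep_sublinear hX U) x00.
  by move=> t tU; apply: x0M; apply: contra tU; exact: (fsubsetP M0U).
pose z t := if t \in U then y t else 0.
have zE M x : (M `<=` U)%fset -> \sum_(t <- M) x t * z t =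
    \sum_(t <- U) (if t \in M then x t else 0) * y t.
  move=> MU; rewrite -(big_fset_incl _ MU).
    by rewrite !big_seq; apply: eq_bigr => t tM; rewrite /z (fsubsetP MU t tM) tM.
  by move=> t _ /negPf->; rewrite mul0r.
have bz M : (M `<=` U)%fset -> dominated M z.
  move=> MU x xge0; rewrite zE//; apply: le_trans (yU _ _) _.
    by move=> t; case: ifP.
  by rewrite tail_dep_restrict//; exact/fsubsetP.
exists z; split=> //.
- move=> t; rewrite /z; case: ifPn => [tU|_]; last by rewrite lexx ler01.
  rewrite y0/=; have := yU _ (@indic_fun_ge0 R T t).
  rewrite (tail_dep_indic hX)//; congr (_ <= _).
  rewrite (bigD1_seq t) ?fset_uniq//= /indic_fun eqxx mul1r big1 ?addr0//.
  by move=> u /negPf ->; rewrite mul0r.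
- have x0E : (fun t => if t \in M0 then x0 t else 0) = x0.
    by apply/funext => t; case: ifPn => // /x0M.
  rewrite zE// -(tail_dep_restrict x0 (fsubsetP M0U)) x0E -yx0.
  by apply: eq_bigr => t _; case: ifPn => // /x0M ->.
Qed.

(** The finite stages form a filter base, directed by union, inside the compact cube. A cluster
    point satisfies all constraints, since each is closed and holds from some stage on. *)
Lemma supporting_point (M0 : {fset T}) (x0 : T -> R) :
  nonneg_orthant x0 -> (forall t, t \notin M0 -> x0 t = 0) ->
  exists y, [/\ nonneg_orthant y, forall M, dominated M y &
    \sum_(t <- M0) x0 t * y t = L M0 x0].
Proof.
move=> x00 x0M.
pose cube : set {ptws T -> R} := [set y | forall t, 0 <= y t <= 1].
pose face : set {ptws T -> R} := [set y | \sum_(t <- M0) x0 t * y t = L M0 x0].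
pose G (U : {fset T}) : set {ptws T -> R} :=
  [set y | [/\ cube y, face y & forall M, (M `<=` U)%fset -> dominated M y]].
pose F := filter_from [set: {fset T}] G.
have FF : ProperFilter F.
  apply: filter_from_proper; last first.
    move=> U _.
    (* [M0] is adjoined because the finite stage needs the support of [x0] inside its index set. *)
    have [|y [y1 yb yx0]] := @supporting_point_fset (U `|` M0)%fset M0 x0 _ x00 x0M.
      exact: fsubsetUr.
    exists y; split=> // M MU; apply: yb; apply: fsubset_trans MU _.
    exact: fsubsetUl.
  apply: filter_from_filter; first by exists fset0.
  move=> U V _ _; exists (U `|` V)%fset => // y [yc yf yb].
  by split; split=> // M MU; apply: yb; apply: fsubset_trans MU _;
    [exact: fsubsetUl|exact: fsubsetUr].
have Fcube : F cube by exists fset0 => // y [].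
have [y [_ yF]] := @compact_cube R T F FF Fcube.
have yC (C : set {ptws T -> R}) : closed C -> F C -> C y.
  by move=> cC FC; apply: cC => A yA; exact: yF.
exists y; split.
- apply: yC; first exact: closed_nonneg_orthant.
  by exists fset0 => // z [z1 _ _] t; have /andP[] := z1 t.
- move=> M x xge0; apply: (yC _ (@closed_halfspace R T M x (L M x))).
  by exists M => // z [_ _ zb]; exact: zb.
- apply: (yC _ (@closed_hyperplane R T M0 x0 (L M0 x0))).
  by exists fset0 => // z [].
Qed.

(** A single intersection over pairs (M, x), shaped for [compact_convex_halfspaces]; [dep_setE]
    identifies it with the dependency set. *)
Definition dep_body : set (T -> R) := nonneg_orthant `&`
  \bigcap_(i in [set i : {fset T} * (T -> R) | i.1 != fset0 /\ nonneg_orthant i.2])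
    [set y | \sum_(t <- i.1) i.2 t * y t <= L i.1 i.2].

Lemma dep_bodyP y : dep_body y <->
  nonneg_orthant y /\ forall M, M != fset0 -> dominated M y.
Proof.
split=> [[y0 yb]|[y0 yb]]; split=> //.
  by move=> M M0 x x0; exact: (yb (M, x)).
by move=> [M x] /= [M0 x0]; exact: yb.
Qed.

Lemma dep_body_max M (x : T -> R) : nonneg_orthant x ->
  (forall t, t \notin M -> x t = 0) ->
  exists2 y, dep_body y & \sum_(t <- M) x t * y t = L M x.
Proof.
move=> x0 xM; have [y [y0 yb yx]] := supporting_point x0 xM.
by exists y => //; apply/dep_bodyP.
Qed.

Lemma dep_body_sup M : M != fset0 -> forall x : M -> R, nonneg_orthant x ->
  stable_tail_dep P X M x =
  ereal_sup [set (\sum_(t : M) x t * y (val t))%:E | y in dep_body].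
Proof.
move=> M0 x x0; rewrite stable_tail_depE//; apply/esym/ereal_sup_max.
  have [y Ky yx] := dep_body_max (extend0_ge0 x0) (extend0_out x).
  by exists y => //; rewrite sum_extend0 yx.
move=> _ [y /dep_bodyP[y0 yb] <-]; rewrite lee_fin sum_extend0.
by apply: yb => //; exact: extend0_ge0.
Qed.

Definition marginal_body M : set (M -> R) := nonneg_orthant `&`
  \bigcap_(x in nonneg_orthant) [set y | \sum_(t : M) x t * y t <= L M (extend0 x)].

Lemma dep_body_proj M y : M != fset0 -> dep_body y -> marginal_body (proj_fset M y).
Proof.
move=> M0 /dep_bodyP[y0 yb]; split=> [t|x x0] /=; first exact: y0.
by rewrite [leLHS](sum_extend0 x y) yb//; exact: extend0_ge0.
Qed.

(** Any candidate obeys the half-space inequalities because its values are bounded by their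
    supremum. That this body itself attains L_M comes from projecting [dep_body], where the supremum
    is already known. *)
Lemma is_largest_marginal_body M : M != fset0 ->
  is_largest (fdd_dep_candidates P X M) (marginal_body (M := M)).
Proof.
move=> M0; split; last first.
  move=> K [[K0 _ _] Ksup] y Ky; split=> [|x x0 /=]; first exact: K0.
  rewrite -lee_fin -stable_tail_depE// Ksup//.
  by apply: ereal_sup_ubound; exists y.
split.
  apply: (@compact_convex_halfspaces R M (M -> R) nonneg_orthant
    (fun=> index_enum M) id (fun x => L M (extend0 x))).
  move=> y t [y0 /(_ _ (@indic_fun_ge0 R M t))] /=.
  rewrite (bigD1_seq t) ?index_enum_uniq ?mem_index_enum//=.
  rewrite {1}/indic_fun eqxx mul1r big1 ?addr0; last first.
    by move=> u /negPf tu; rewrite /indic_fun tu mul0r.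
  rewrite (_ : extend0 _ = indic_fun (val t)).
    by rewrite (tail_dep_indic hX)//; exact: valP.
  apply/funext => u; rewrite /indic_fun.
  have [uM|uM] := boolP (u \in M).
    by rewrite -[u]/(val [` uM]%fset) extend0_val val_eqE.
  by rewrite extend0_out//; case: eqVneq uM => // ->; rewrite (valP t).
move=> x x0; rewrite (dep_body_sup M0)//.
apply/eqP; rewrite eq_le; apply/andP; split; apply: ge_ereal_sup.
  move=> _ [y Ky <-]; apply: ereal_sup_ubound.
  by exists (proj_fset M y) => //; exact: dep_body_proj.
move=> _ [y [y0 yb] <-]; rewrite -(dep_body_sup M0)// stable_tail_depE// lee_fin.
exact: yb.
Qed.

Lemma fdd_dep_setE M : M != fset0 -> fdd_dep_set P X M = marginal_body (M := M).
Proof.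
move=> M0; apply: xget_unique; first exact: is_largest_marginal_body.
by move=> K HK; apply: is_largest_unique HK _; exact: is_largest_marginal_body.
Qed.

Lemma dep_setE : dep_set P X = dep_body.
Proof.
apply/seteqP; split=> y [y0 yb].
  apply/dep_bodyP; split=> // M M0 x x0.
  have := yb M M0; rewrite /preimage/= fdd_dep_setE// => -[_].
  (* The weights are cut down to [M] and extended by zero; neither the sum over [M] nor L_M notices
     the change. *)
  have xM0 : nonneg_orthant (fun t : M => x (val t)) by move=> t; exact: x0.
  move=> /(_ _ xM0) /=; rewrite [leLHS](sum_extend0 (fun t : M => x (val t)) y).
  have xE t : t \in M -> extend0 (fun t : M => x (val t)) t = x t.
    by move=> tM; rewrite -[t]/(val [` tM]%fset) extend0_val.
  congr (_ <= _).
    by rewrite !big_seq; apply: eq_bigr => t tM; rewrite xE.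
  rewrite /tail_dep; congr (- ln (fine (P _))).
  by apply/seteqP; split=> w H t tM; have := H t tM; rewrite xE.
split=> // M M0; rewrite /preimage/= fdd_dep_setE//.
exact: dep_body_proj.
Qed.

End dependency_set.

Theorem lemma29 (R : realType) (T : choiceType)
    (d : measure_display) (Omega : measurableType d) (P : probability Omega R)
    (X : T -> {RV P >-> R}) (hX : simple_max_stable P X) :
  is_largest
    [set K : set (T -> R) | compact_convex_orthant K /\
      forall M : {fset T}, M != fset0 ->
      forall x : M -> R, nonneg_orthant x ->
        stable_tail_dep P X M x =
        ereal_sup [set (\sum_(t : M) x t * y (val t))%:E | y in K]]
    (dep_set P X).
Proof.
rewrite (dep_setE hX); split.
  split; last exact: (dep_body_sup hX).
  apply: compact_convex_halfspaces => y t /dep_bodyP[y0 yb].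
  exact: (dominated_le1 hX) y0 yb t.
(* Maximality: each value of a linear form on [K] is at most its supremum L_M, so the projection of
   [y] lies in every marginal body. *)
move=> K [[K0 _ _] Ksup] y Ky; rewrite -(dep_setE hX).
split=> [|M M0]; first exact: K0.
rewrite /preimage/= (fdd_dep_setE hX)//.
split=> [t|x x0 /=]; first exact: (K0 _ Ky).
rewrite -lee_fin -(stable_tail_depE hX)// Ksup//.
by apply: ereal_sup_ubound; exists y.
Qed.
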